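(* Let $\alpha\in\mathbb C\setminus\{-1,-2,-3,\dots\}$. The following are generating functions of the form $A(t)F(xtA(t)-R(t))$ for the monic Laguerre polynomials $L_n^{(\alpha)}(x)$. (1) $A(t)=\frac{1}{1-t}$, $R(t)=-\alpha\ln(1-t)$, $F(t)=e^{-t}$, giving $$\sum_{n\ge0}L_n^{(\alpha)}(x)\frac{(-t)^n}{n!}=(1-t)^{-\alpha-1}e^{\frac{xt}{t-1}}.$$ (2) $A(t)=\frac1{1-t}$, $R(t)=0$, $F(t)={}_1F_1(1;\alpha+1;-t)$, giving $$\sum_{n\ge0}\frac{(-1)^n}{(\alpha+1)_n}L_n^{(\alpha)}(x)t^n=\frac{1}{1-t}\;{}_1F_1\Big(1;\alpha+1;\frac{xt}{t-1}\Big).$$ Conversely, these are the only ones: every generating function of the form $A(t)F(xtA(t)-R(t))$ of $\{L_n^{(\alpha)}\}$ is, up to rescaling of $t$, one of (1), (2).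
   Context: All power series are formal power series with complex coefficients. $(\mu)_0=1$, $(\mu)_n=\mu(\mu+1)\cdots(\mu+n-1)$. A monic polynomial set (MPS) is a sequence $\{P_n(x)\}_{n\ge0}$ with $P_n(x)=x^n+$ lower degree terms. Generating function of the form $A(t)F(xtA(t)-R(t))$ for an MPS $\{P_n\}$: data $\big((\alpha_n)_{n\ge0},A,R,F\big)$ where $\alpha_n\in\mathbb C$, $\alpha_n\ne0$ for all $n$, $\alpha_0=1$, $F(t)=\sum_{n\ge0}\alpha_nt^n$, and $A,R$ are formal power series with $A(0)=1$, $R(0)=0$, such that $$A(t)F(xtA(t)-R(t))=\sum_{n\ge0}\alpha_nP_n(x)t^n$$ as formal power series in $t$ with coefficients in $\mathbb C[x]$. Rescaling of $t$ by $c\in\mathbb C\setminus\{0\}$ is $(\alpha_n,A(t),R(t),F(t))\mapsto(c^n\alpha_n,A(ct),c^{-1}R(ct),F(ct))$, which gives another generating function of the same MPS. The monic Laguerre polynomials are $L_n^{(\alpha)}(x)=(-1)^n(\alpha+1)_n\,{}_1F_1(-n;\alpha+1;x)$. *)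

(* Defs.v *)
From HB Require Import structures.
From mathcomp Require Import all_boot all_order all_algebra.
From mathcomp Require Import boolp reals.

Set Implicit Arguments.
Unset Strict Implicit.
Unset Printing Implicit Defensive.

Import GRing.Theory.
Local Open Scope ring_scope.

Reserved Notation "c %:S" (at level 1, left associativity, format "c %:S").
Reserved Notation "F \So G" (at level 50).

Record fps (K : Type) := Fps { coef_fps :> nat -> K }.

Lemma fpsP (K : Type) (f g : fps K) : f =1 g -> f = g.
Proof. by case: f g => [f] [g] /= /funext ->. Qed.

HB.instance Definition _ (K : Type) := gen_eqMixin (fps K).
HB.instance Definition _ (K : Type) := gen_choiceMixin (fps K).

Section FpsRing.
Variable K : comNzRingType.
Implicit Types f g h : fps K.

Definition add_fps f g := Fps (fun n => f n + g n).
Definition opp_fps f := Fps (fun n => - f n).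
Definition const_fps (c : K) := Fps (fun n => if n is 0 then c else 0).
Definition mul_fps f g := Fps (fun n => \sum_(i < n.+1) f i * g (n - i)%N).

Fact add_fpsA : associative add_fps.
Proof. by move=> f g h; apply: fpsP => n /=; rewrite addrA. Qed.
Fact add_fpsC : commutative add_fps.
Proof. by move=> f g; apply: fpsP => n /=; rewrite addrC. Qed.
Fact add0_fps : left_id (const_fps 0) add_fps.
Proof. by move=> f; apply: fpsP => -[|n] /=; rewrite add0r. Qed.
Fact addN_fps : left_inverse (const_fps 0) opp_fps add_fps.
Proof. by move=> f; apply: fpsP => -[|n] /=; rewrite addNr. Qed.

HB.instance Definition _ :=
  GRing.isZmodule.Build (fps K) add_fpsA add_fpsC add0_fps addN_fps.

(* Associativity is inherited from polynomials: the n-th coefficient of a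
   product depends only on the truncations of the factors at order n. *)
Let agree n (p : {poly K}) f := forall m, (m <= n)%N -> p`_m = f m.

Let agree_trunc n f : agree n (\poly_(i < n.+1) f i) f.
Proof. by move=> m le_mn; rewrite coef_poly ltnS le_mn. Qed.

Let agreeM n p q f g :
  agree n p f -> agree n q g -> agree n (p * q) (mul_fps f g).
Proof.
move=> pf qg m le_mn; rewrite coefM /=; apply: eq_bigr => i _.
rewrite pf ?qg //; first exact: leq_trans (leq_subr _ _) le_mn.
by rewrite (leq_trans _ le_mn) // -ltnS.
Qed.

Fact mul_fpsA : associative mul_fps.
Proof.
move=> f g h; apply: fpsP => n.
have [[F G] H] := (@agree_trunc n f, @agree_trunc n g, @agree_trunc n h).
have /(_ n (leqnn n)) <- := agreeM F (agreeM G H).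
by have /(_ n (leqnn n)) <- := agreeM (agreeM F G) H; rewrite mulrA.
Qed.

Fact mul_fpsC : commutative mul_fps.
Proof.
move=> f g; apply: fpsP => n.
have [F G] := (@agree_trunc n f, @agree_trunc n g).
have /(_ n (leqnn n)) <- := agreeM F G.
by have /(_ n (leqnn n)) <- := agreeM G F; rewrite mulrC.
Qed.

Fact mul1_fps : left_id (const_fps 1) mul_fps.
Proof.
move=> f; apply: fpsP => n /=.
rewrite big_ord_recl /= mul1r subn0 big1 ?addr0 // => i _.
by rewrite mul0r.
Qed.

Fact mul_fpsDl : left_distributive mul_fps add_fps.
Proof.
move=> f g h; apply: fpsP => n /=; rewrite -big_split /=.
by apply: eq_bigr => i _; rewrite mulrDl.
Qed.

Fact fps1_neq0 : const_fps 1 != const_fps 0.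
Proof.
by apply/eqP => /(congr1 (fun f => coef_fps f 0%N)) /= /eqP; rewrite oner_eq0.
Qed.

HB.instance Definition _ := GRing.Zmodule_isComNzRing.Build (fps K)
  mul_fpsA mul_fpsC mul1_fps mul_fpsDl fps1_neq0.

Definition fpsX : fps K := Fps (fun n => (n == 1%N)%:R).

(* Meaningful only when [G] has zero constant coefficient: then [G ^+ k] has
   no coefficient below order [k], so the sum may stop at [k = n]. *)
Definition comp_fps (F G : fps K) : fps K :=
  Fps (fun n => \sum_(k < n.+1) F k * (G ^+ k) n).

Lemma coef_fps0 n : (0 : fps K) n = 0.
Proof. by case: n. Qed.

Lemma coef_fps1 n : (1 : fps K) n = (n == 0%N)%:R.
Proof. by case: n. Qed.

Lemma coef_fpsD f g n : (f + g) n = f n + g n.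
Proof. by []. Qed.

Lemma coef_fpsN f n : (- f) n = - f n.
Proof. by []. Qed.

Lemma coef_fpsM f g n : (f * g) n = \sum_(i < n.+1) f i * g (n - i)%N.
Proof. by []. Qed.

Lemma coef_fpsM0 f g : (f * g) 0%N = f 0%N * g 0%N.
Proof. by rewrite coef_fpsM big_ord1. Qed.

Lemma coef_fps_sum (I : Type) (r : seq I) (P : pred I) (F : I -> fps K) n :
  (\sum_(i <- r | P i) F i) n = \sum_(i <- r | P i) F i n.
Proof.
apply: (big_morph (fun f : fps K => f n)) => [f g|]; first exact: coef_fpsD.
exact: coef_fps0.
Qed.

Lemma coef_fpsX_lt f k n : f 0%N = 0 -> (n < k)%N -> (f ^+ k) n = 0.
Proof.
move=> f0; elim: k n => // k IHk n lt_nk; rewrite exprS coef_fpsM.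
apply: big1 => -[[|i] /= lt_in] _; first by rewrite f0 mul0r.
case: n lt_in lt_nk => [|n] //= _ lt_nk.
by rewrite IHk ?mulr0 // subSS (leq_ltn_trans (leq_subr _ _)).
Qed.

End FpsRing.

Arguments fpsX {K}.
Notation "c %:S" := (const_fps c) : ring_scope.
Notation "F \So G" := (comp_fps F G) : ring_scope.

Section FpsUnitRing.
Variable K : comUnitRingType.
Implicit Types f g : fps K.

Definition unit_fps : {pred fps K} := fun f => f 0%N \is a GRing.unit.

(* [f = f_0 (1 - u)] with [u] without constant coefficient, so that [f^-1] is
   [f_0^-1] times the geometric series in [u]. *)
Definition inv_fps f : fps K :=
  if unit_fps f
  then ((f 0%N)^-1)%:S * (Fps (fun=> 1) \So (1 - ((f 0%N)^-1)%:S * f))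
  else f.

Fact mulV_fps : {in unit_fps, left_inverse 1 inv_fps *%R}.
Proof.
move=> f uf; rewrite /inv_fps ifT; last exact: uf.
rewrite unfold_in /= in uf.
set c := _%:S; set u := 1 - c * f.
have u0 : u 0%N = 0.
  by rewrite coef_fpsD coef_fpsN coef_fpsM0 coef_fps1 /= mulVr // subrr.
rewrite mulrAC; have ->: c * f = 1 - u by rewrite /u opprB addrCA subrr addr0.
apply: fpsP => n.
have geo m : (m <= n)%N ->
    (Fps (fun=> 1) \So u) m = (\sum_(k < n.+1) u ^+ k) m.
  move=> le_mn; rewrite /= coef_fps_sum.
  rewrite (big_ord_widen n.+1 (fun k => 1 * (u ^+ k) m)) // big_mkcond /=.
  apply: eq_bigr => k _; rewrite mul1r; case: ltnP => // lt_mk.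
  by rewrite coef_fpsX_lt.
transitivity (((1 - u) * \sum_(k < n.+1) u ^+ k) n).
  by rewrite !coef_fpsM; apply: eq_bigr => i _; rewrite geo // leq_subr.
rewrite -opprB mulNr -subrX1 opprB coef_fpsD coef_fpsN.
by rewrite coef_fpsX_lt // subr0.
Qed.

Fact unit_fpsPl f g : g * f = 1 -> unit_fps f.
Proof.
move=> gf1; apply/unitrPr; exists (g 0%N).
by rewrite mulrC -coef_fpsM0 gf1 coef_fps1.
Qed.

Fact inv_fps_out : {in [predC unit_fps], inv_fps =1 id}.
Proof. by move=> f /negbTE nuf; rewrite /inv_fps ifF. Qed.

HB.instance Definition _ := GRing.ComNzRing_hasMulInverse.Build (fps K)
  mulV_fps unit_fpsPl inv_fps_out.

End FpsUnitRing.

Definition map_fps (K L : Type) (h : K -> L) (f : fps K) : fps L :=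
  Fps (fun n => h (f n)).

Section Series.
Variable K : fieldType.
Implicit Types a b : K.

Definition pochhammer a n : K := \prod_(i < n) (a + i%:R).

Definition exp_fps : fps K := Fps (fun n => (n`!%:R)^-1).

(* [ln (1 + t)]; the coefficient of order 0 vanishes since [0^-1 = 0]. *)
Definition ln1p_fps : fps K := Fps (fun n => (-1) ^+ n.+1 / n%:R).

(* [(1 + t) ^ a], Newton's binomial series. *)
Definition pow1p_fps a : fps K :=
  Fps (fun n => (\prod_(i < n) (a - i%:R)) / n`!%:R).

Definition hyp1F1_fps a b : fps K :=
  Fps (fun n => pochhammer a n / (pochhammer b n * n`!%:R)).

(* [1F1 (- n; a + 1; x)] has degree at most [n] in [x], as [(- n)_k = 0] for
   [k > n]. *)
Definition laguerre a n : {poly K} :=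
  ((-1) ^+ n * pochhammer (a + 1) n)
    *: \poly_(k < n.+1) hyp1F1_fps (- n%:R) (a + 1) k.

End Series.

Arguments exp_fps {K}.
Arguments ln1p_fps {K}.

Section GeneratingFunctions.
Variable K : fieldType.
Implicit Types (P : nat -> {poly K}) (A R F : fps K).

Definition monic_poly_set P :=
  forall n, P n \is monic /\ size (P n) = n.+1.

(* A series in [t] alone, seen as a series in [t] over [K[x]]. *)
Definition lift_fps F : fps {poly K} := map_fps polyC F.

Record genfun_data := GenFun {
  gf_alpha : nat -> K;
  gf_A : fps K;
  gf_R : fps K;
  gf_F : fps K
}.

Definition is_genfun P (d : genfun_data) :=
  let: GenFun alpha A R F := d in
  [/\ monic_poly_set P,
      (forall n, alpha n != 0) /\ alpha 0%N = 1,
      F = Fps alpha,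
      A 0%N = 1 /\ R 0%N = 0 &
      lift_fps A * (lift_fps F \So ('X%:S * fpsX * lift_fps A - lift_fps R))
      = Fps (fun n => alpha n *: P n)].

Definition rescale (c : K) (d : genfun_data) :=
  let: GenFun alpha A R F := d in
  let ct := c%:S * fpsX in
  GenFun (fun n => c ^+ n * alpha n)
         (A \So ct) ((c^-1)%:S * (R \So ct)) (F \So ct).

End GeneratingFunctions.

Section Laguerre.
Variables (K : fieldType) (a : K).

Definition laguerre_gf1 : genfun_data K :=
  GenFun (fun n => (-1) ^+ n / n`!%:R)
         (1 - fpsX)^-1
         (- (a%:S * (ln1p_fps \So (- fpsX))))
         (exp_fps \So (- fpsX)).

Definition laguerre_gf2 : genfun_data K :=
  GenFun (fun n => (-1) ^+ n / pochhammer (a + 1) n)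
         (1 - fpsX)^-1
         0
         (hyp1F1_fps 1 (a + 1) \So (- fpsX)).

Definition laguerre_arg : fps {poly K} := 'X%:S * fpsX / (fpsX - 1).

End Laguerre.

Arguments laguerre_arg {K}.

(* Main.v *)
Require Import Defs.
From HB Require Import structures.
From mathcomp Require Import all_boot all_order all_algebra.
From mathcomp Require Import boolp reals complex ring.

Set Implicit Arguments.
Unset Strict Implicit.
Unset Printing Implicit Defensive.

Import Order.TTheory GRing.Theory Num.Theory.
Local Open Scope ring_scope.

(** Expanding [(x t A - R)^j] by the binomial formula and reading off the
    coefficient of [x^k t^(k+m)] turns the identity
    [A F(x t A - R) = sum_n alpha_n P_n t^n] into the numerical relations
      [alpha_(k+m) p_(k+m,k)
         = sum_(i <= m) alpha_(k+i) C(k+i,k) [t^m] A^(k+1) (-R)^i],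
    one for each [k] and [m], where [p_(n,k)] is the coefficient of [x^k] in
    [P_n] ([coef_genfun], [genfunP]). Everything rests on these relations,
    together with the closed form
      [p_(k+m,k) = (-1)^m C(k+m,k) (a+1+k)_m]
    of the Laguerre coefficients ([coef_laguerre]).

    That (1) and (2) are generating functions then amounts to computing
    coefficients of powers [(1 - t)^(-b)]: in (2) the series [R] vanishes and
    only the term [i = 0] remains, while in (1) the sum over [i] reassembles
    [A^(k+1) exp(R) = (1 - t)^(-(a+1+k))]. The series [(1 - t)^(-b)] is handled
    through the differential equation [(1 - t) f' = b f] that characterises it
    ([negbin_fps_odeP]), which makes the product rule and
    [exp(-a ln(1 - t)) = (1 - t)^(-a)] immediate.

    For the converse, let [c = A_1] and [r = R_1 - a]. The relations for
    [m = 1] say that [alpha_(k+1) (r - k - 1) = c alpha_k] ([alpha_rec]); so [c]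
    is nonzero and, up to rescaling by [c], the sequence [alpha] depends on [r]
    only. Using this recurrence to eliminate [alpha], the relations for [m = 2]
    say that a polynomial of degree at most 2 in [k] vanishes at all natural
    numbers, hence identically. Its coefficients and its value at [-2] leave
    only [r = 0] and [r = - a] ([genfun_r_cases]), and these give the sequences
    [alpha] of (1) and of (2). Finally [alpha] determines the generating
    function ([genfun_uniq]): each further coefficient of [A] and of [R] is the
    solution of an invertible system of two linear equations. *)

(** * Coefficients of formal power series *)

Section Coefficients.
Variable K : comNzRingType.
Implicit Types (f g h : fps K) (c : K).

Lemma coef_fpsB f g n : (f - g) n = f n - g n.
Proof. by []. Qed.

Lemma coef_fpsMn f k n : (f *+ k) n = f n *+ k.
Proof.
elim: k => [|k IHk]; first by rewrite !mulr0n coef_fps0.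
by rewrite !mulrS coef_fpsD IHk.
Qed.

Lemma coef_const_fpsM c f n : (c%:S * f) n = c * f n.
Proof.
by rewrite coef_fpsM big_ord_recl /= subn0 big1 ?addr0 // => i _; rewrite mul0r.
Qed.

Lemma const_fpsM c d : (c * d)%:S = c%:S * d%:S :> fps K.
Proof. by apply: fpsP => -[|n]; rewrite coef_const_fpsM //= mulr0. Qed.

Lemma const_fps_exp c k : (c ^+ k)%:S = c%:S ^+ k :> fps K.
Proof. by elim: k => // k IHk; rewrite !exprS const_fpsM IHk. Qed.

Lemma const_fpsN1 : (-1)%:S = -1 :> fps K.
Proof. by apply: fpsP => -[|n] //=; rewrite oppr0. Qed.

Lemma coef_fpsX_mul f n : (fpsX * f) n = if n is m.+1 then f m else 0.
Proof.
case: n => [|n]; first by rewrite coef_fpsM0 mul0r.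
rewrite coef_fpsM big_ord_recl mul0r add0r big_ord_recl /= mul1r subSS subn0.
by rewrite big1 ?addr0 // => i _; rewrite mul0r.
Qed.

Lemma coef_fpsXn_mul f k m : (fpsX ^+ k * f) (k + m)%N = f m.
Proof. by elim: k => [|k IHk]; rewrite ?mul1r // exprS -mulrA coef_fpsX_mul. Qed.

Lemma coef_fps_exp0 f k : (f ^+ k) 0%N = f 0%N ^+ k.
Proof. by elim: k => // k IHk; rewrite !exprS coef_fpsM0 IHk. Qed.

(** The powers of a series without constant term have increasing order, so
    that cutting the sum defining the composite at a higher order than
    prescribed changes nothing; hence multiplication by a series distributes
    over the composite coefficientwise. *)
Lemma coef_mul_comp h f g n : g 0%N = 0 ->
  (h * (f \So g)) n = \sum_(j < n.+1) f j * (h * g ^+ j) n.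
Proof.
move=> g0; rewrite coef_fpsM.
under eq_bigr => i _.
  rewrite /= (big_ord_widen n.+1 (fun k => f k * (g ^+ k) (n - i)%N)); last first.
    by rewrite ltnS leq_subr.
  rewrite big_mkcond /= mulr_sumr.
  under eq_bigr => k _.
    rewrite (_ : (if _ then _ else _) = f k * (g ^+ k) (n - i)%N); last first.
      by case: ltnP => // lt_ik; rewrite coef_fpsX_lt ?mulr0.
    rewrite mulrCA; over.
  over.
rewrite exchange_big /=; apply: eq_bigr => j _.
by rewrite mulr_sumr.
Qed.

Lemma coef_fpsXn k n : (fpsX ^+ k : fps K) n = (n == k)%:R.
Proof.
elim: k n => [|k IHk] n; first by rewrite coef_fps1.
by rewrite exprS coef_fpsX_mul; case: n.
Qed.

Lemma coef_compZX f c n : (f \So (c%:S * fpsX)) n = c ^+ n * f n.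
Proof.
rewrite [LHS]/=; under eq_bigr => k _.
  rewrite exprMn -const_fps_exp coef_const_fpsM coef_fpsXn.
  over.
rewrite big_ord_recr big1 /= ?eqxx ?add0r ?mulr1 1?mulrC // => i _.
by rewrite gtn_eqF ?mulr0.
Qed.

Lemma coef_compNX f n : (f \So (- fpsX)) n = (-1) ^+ n * f n.
Proof. by rewrite -[- fpsX]mulN1r -const_fpsN1 coef_compZX. Qed.

Lemma compZX_mul f g c :
  (f * g) \So (c%:S * fpsX) = (f \So (c%:S * fpsX)) * (g \So (c%:S * fpsX)).
Proof.
apply: fpsP => n; rewrite coef_compZX !coef_fpsM mulr_sumr.
apply: eq_bigr => i _; rewrite !coef_compZX mulrACA -exprD subnKC //.
by rewrite -ltnS.
Qed.

Lemma compZX_exp f c k : (f ^+ k) \So (c%:S * fpsX) = (f \So (c%:S * fpsX)) ^+ k.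
Proof.
elim: k => [|k IHk]; last by rewrite !exprS compZX_mul IHk.
apply: fpsP => n; rewrite coef_compZX !expr0 coef_fps1.
by case: n => [|n]; rewrite /= ?mulr1 ?mulr0.
Qed.

End Coefficients.

(** * Coefficients of a generating function *)

Section Lift.
Variable K : fieldType.
Implicit Types (f g A B F R : fps K).

Fact lift_fps_is_zmod_morphism : zmod_morphism (@lift_fps K).
Proof. by move=> f g; apply: fpsP => n /=; rewrite polyCB. Qed.

Fact lift_fps_is_monoid_morphism : monoid_morphism (@lift_fps K).
Proof.
split; first by apply: fpsP => -[|n].
move=> f g; apply: fpsP => n.
rewrite coef_fpsM /= rmorph_sum /=.
by apply: eq_bigr => i _; rewrite polyCM.
Qed.

HB.instance Definition _ := GRing.isZmodMorphism.Build _ _ (@lift_fps K)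
  lift_fps_is_zmod_morphism.
HB.instance Definition _ := GRing.isMonoidMorphism.Build _ _ (@lift_fps K)
  lift_fps_is_monoid_morphism.

Lemma lift_fpsX : lift_fps fpsX = fpsX :> fps {poly K}.
Proof. by apply: fpsP => n /=; rewrite polyC_natr. Qed.

(** By the binomial formula, [x^k] occurs in [(x t A - R)^j] with coefficient
    [C(j,k) (t A)^k (-R)^(j-k)]. *)
Lemma sum_coef_genfun A B F R n k : R 0%N = 0 ->
  ((lift_fps B * (lift_fps F \So ('X%:S * fpsX * lift_fps A - lift_fps R))) n)`_k
  = \sum_(j < n.+1) F j * ((B * (fpsX * A) ^+ k * (- R) ^+ (j - k)) n *+ 'C(j, k)).
Proof.
move=> R0; rewrite coef_mul_comp; last first.
  rewrite coef_fpsB -mulrA coef_const_fpsM coef_fpsX_mul /= R0.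
  by rewrite polyC0 mulr0 subr0.
rewrite coef_sum; apply: eq_bigr => j _; rewrite coefCM; congr (_ * _).
rewrite addrC -rmorphN -mulrA -lift_fpsX -rmorphM exprDn mulr_sumr.
rewrite coef_fps_sum coef_sum.
under eq_bigr => i _.
  rewrite mulrnAr exprMn -!rmorphXn -const_fps_exp mulrCA -rmorphM mulrCA -rmorphM.
  rewrite coef_fpsMn coef_const_fpsM coefMn coefMC coefXn.
  over.
have [le_kj|lt_jk] := leqP k j; last first.
  rewrite bin_small // mulr0n big1 // => i _.
  by rewrite gtn_eqF ?mul0r ?mul0rn // (leq_ltn_trans _ lt_jk) // -ltnS.
have lt_kj : (k < j.+1)%N by rewrite ltnS.
rewrite (bigD1 (Ordinal lt_kj)) // big1; last first.
  move=> i; rewrite -val_eqE eq_sym => /negbTE neq_ik.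
  by rewrite [k == i]neq_ik mul0r mul0rn.
by rewrite [k == _]eqxx mul1r [LHS]addr0 mulrA mulrAC.
Qed.

(** Every [x] is accompanied by a [t], so the natural second index is the excess
    [m] of the order in [t] over the degree in [x]. *)
Lemma coef_genfun A B F R k m : R 0%N = 0 ->
  ((lift_fps B * (lift_fps F \So ('X%:S * fpsX * lift_fps A - lift_fps R)))
     (k + m)%N)`_k
  = \sum_(i < m.+1) F (k + i)%N * ((B * A ^+ k * (- R) ^+ i) m *+ 'C(k + i, k)).
Proof.
move=> R0; rewrite sum_coef_genfun // -addnS big_split_ord.
rewrite big1 => [|i _]; last first.
  by rewrite bin_small ?mulr0n ?mulr0 ?(ltn_ord i).
rewrite [LHS]add0r; apply: eq_bigr => i _; congr (_ * (_ *+ _)).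
rewrite exprMn [LHS](_ : _ = (fpsX ^+ k * (B * A ^+ k * (- R) ^+ i)) (k + m)%N).
  by rewrite coef_fpsXn_mul.
by rewrite [(k + i - k)%N]addKn mulrCA !mulrA.
Qed.

Lemma coef_genfun_gt A B F R k n : R 0%N = 0 -> (n < k)%N ->
  ((lift_fps B * (lift_fps F \So ('X%:S * fpsX * lift_fps A - lift_fps R))) n)`_k
  = 0.
Proof.
move=> R0 lt_nk; rewrite sum_coef_genfun // big1 // => j _.
by rewrite bin_small ?mulr0n ?mulr0 // (leq_trans _ lt_nk).
Qed.

(** The outer factor [B] is kept independent of [A] because the exponential
    form of the Laguerre generating function merges [A] with [exp(R)]. *)
Lemma genfunP A B F R (Q : nat -> {poly K}) : R 0%N = 0 ->
    (forall n, size (Q n) <= n.+1)%N ->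
  lift_fps B * (lift_fps F \So ('X%:S * fpsX * lift_fps A - lift_fps R)) = Fps Q
  <-> forall k m, (Q (k + m)%N)`_k =
      \sum_(i < m.+1) F (k + i)%N * ((B * A ^+ k * (- R) ^+ i) m *+ 'C(k + i, k)).
Proof.
move=> R0 szQ; split=> [eqQ k m|eqQ]; first by rewrite -coef_genfun // eqQ.
apply: fpsP => n; apply/polyP => k; have [le_kn|lt_nk] := leqP k n.
  by rewrite -(subnKC le_kn) coef_genfun // -eqQ.
by rewrite coef_genfun_gt // [RHS]nth_default // (leq_trans (szQ n)).
Qed.

Lemma genfun0P A B F (Q : nat -> {poly K}) : (forall n, size (Q n) <= n.+1)%N ->
  lift_fps B * (lift_fps F \So ('X%:S * fpsX * lift_fps A)) = Fps Q
  <-> forall k m, (Q (k + m)%N)`_k = F k * (B * A ^+ k) m.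
Proof.
move=> szQ; rewrite -[_ * lift_fps A]subr0 -(rmorph0 (@lift_fps K)) genfunP //.
suff eqF k m : \sum_(i < m.+1)
     F (k + i)%N * ((B * A ^+ k * (- 0) ^+ i) m *+ 'C(k + i, k))
   = F k * (B * A ^+ k) m by split=> eqQ k m; rewrite eqQ eqF.
rewrite big_ord_recl addn0 binn mulr1n mulr1 big1 ?[LHS]addr0 // => i _.
by rewrite oppr0 expr0n mulr0 coef_fps0 mul0rn mulr0.
Qed.

(** Rescaling multiplies both sides of the coefficient relations by
    [c^(k+m)]. *)
Lemma is_genfun_rescale (P : nat -> {poly K}) d (c : K) :
  c != 0 -> is_genfun P d -> is_genfun P (rescale c d).
Proof.
move=> c0; case: d => alpha A R F [mP [alpha_neq0 alpha0] -> [A0 R0] eqP].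
have szP n (b : K): (size (b *: P n) <= n.+1)%N.
  by rewrite (leq_trans (size_scale_leq _ _)) // (mP n).2.
have cR0 : ((c^-1)%:S * (R \So (c%:S * fpsX))) 0%N = 0.
  by rewrite coef_const_fpsM coef_compZX R0 !mulr0.
split=> //.
- by split=> [n|]; rewrite ?mulf_neq0 ?expf_neq0 // alpha0 mulr1.
- by apply: fpsP => n; rewrite coef_compZX.
- by rewrite coef_compZX A0 mulr1.
apply/genfunP => // k m; move/genfunP: eqP => /(_ R0 (fun n => szP n _)) eqP.
rewrite coefZ -mulrA -coefZ eqP mulr_sumr; apply: eq_bigr => i _.
have -> : (- ((c^-1)%:S * (R \So (c%:S * fpsX)))) ^+ i
        = (c^-1 ^+ i)%:S * ((- R) ^+ i \So (c%:S * fpsX)).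
  rewrite const_fps_exp compZX_exp -exprMn -mulrN; congr ((_ * _) ^+ _).
  by apply: fpsP => n; rewrite coef_fpsN !coef_compZX coef_fpsN mulrN.
rewrite [_ * _ * (_%:S * _)]mulrCA coef_const_fpsM -compZX_exp -!compZX_mul.
rewrite [(Fps alpha \So _) _]coef_compZX [(_ \So _) m]coef_compZX.
rewrite -[in LHS]mulr_natr -[in RHS]mulr_natr exprVn !exprD.
move: (coef_fps _ m) (coef_fps _ (k + i)%N) ('C(_, _)%:R) => x y C.
by have ci0 := expf_neq0 i c0; field.
Qed.

End Lift.

(** * Pochhammer symbols *)

Section Pochhammer.
Variable K : fieldType.
Implicit Types a b : K.

Lemma pochhammer0 a : pochhammer a 0 = 1.
Proof. by rewrite /pochhammer big_ord0. Qed.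

Lemma pochhammerS a n : pochhammer a n.+1 = pochhammer a n * (a + n%:R).
Proof. by rewrite /pochhammer big_ord_recr. Qed.

Lemma pochhammerD a k m :
  pochhammer a (k + m) = pochhammer a k * pochhammer (a + k%:R) m.
Proof.
elim: m => [|m IHm]; first by rewrite addn0 pochhammer0 mulr1.
by rewrite addnS !pochhammerS IHm -mulrA natrD addrA.
Qed.

Lemma pochhammer1 n : pochhammer 1 n = n`!%:R :> K.
Proof.
elim: n => [|n IHn]; first by rewrite pochhammer0.
by rewrite pochhammerS IHn factS mulnC natrM -natr1 addrC.
Qed.

Lemma pochhammer_natN k m :
  pochhammer (- (k + m)%:R) k * m`!%:R = (-1) ^+ k * (k + m)`!%:R :> K.
Proof.
elim: k => [|k IHk]; first by rewrite pochhammer0.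
rewrite /pochhammer big_ord_recl mulr0n addr0 -mulrA.
under eq_bigr => i _.
  rewrite (_ : _ + _ = - (k + m)%:R + i%:R); last first.
    rewrite /= /bump /= addSn -[(k + m).+1]addn1 -[(1 + i)%N]addn1 !natrD; ring.
  over.
by rewrite -/(pochhammer _ k) IHk addSn factS natrM exprS; ring.
Qed.

Lemma pochhammer_neq0 a n :
  (forall k, a != - k.+1%:R) -> pochhammer (a + 1) n != 0.
Proof.
move=> ha; apply/prodf_neq0 => i _.
by rewrite -addrA nat1r addr_eq0.
Qed.

End Pochhammer.

(** * The series of [(1 - t)^(-b)] *)

Section Deriv.
Variable K : comNzRingType.
Implicit Types f g : fps K.

Definition deriv_fps f : fps K := Fps (fun n => f n.+1 *+ n.+1).

Lemma deriv_fpsM f g : deriv_fps (f * g) = deriv_fps f * g + f * deriv_fps g.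
Proof.
apply: fpsP => n; rewrite coef_fpsD.
transitivity (\sum_(i < n.+2) (f i * g (n.+1 - i)%N *+ i
                               + f i * g (n.+1 - i)%N *+ (n.+1 - i))).
  rewrite -[LHS]/((\sum_(i < n.+2) f i * g (n.+1 - i)%N) *+ n.+1) -sumrMnl.
  apply: eq_bigr => i _; rewrite -mulrnDr subnKC //.
  by rewrite -ltnS.
rewrite big_split; congr (_ + _).
  rewrite big_ord_recl mulr0n [LHS]add0r coef_fpsM; apply: eq_bigr => i _.
  by rewrite /= mulrnAl subSS.
rewrite big_ord_recr subnn mulr0n [LHS]addr0 coef_fpsM; apply: eq_bigr => i _.
by rewrite /= mulrnAr subSn // -ltnS.
Qed.

Lemma deriv_fpsX f k : deriv_fps (f ^+ k.+1) = f ^+ k * deriv_fps f *+ k.+1.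
Proof.
elim: k => [|k IHk]; first by rewrite mul1r.
by rewrite exprS deriv_fpsM IHk mulrnAr mulrA -exprS
            [deriv_fps f * _]mulrC -mulrS.
Qed.

End Deriv.

Section Binomial.
Variable K : numFieldType.
Implicit Types (a b c : K) (f g R : fps K).

(** The negative binomial series, that is, the expansion of [(1 - t)^(-b)]. *)
Definition negbin_fps b : fps K := Fps (fun n => pochhammer b n / n`!%:R).

Lemma factr_neq0 n : n`!%:R != 0 :> K.
Proof. by rewrite pnatr_eq0 -lt0n fact_gt0. Qed.

Lemma negbin_fps0 b : negbin_fps b 0%N = 1.
Proof. by rewrite /= pochhammer0 invr1 mulr1. Qed.

(** The equation [(1 - t) f' = b f] is a recurrence
    [(n + 1) f_(n+1) = (b + n) f_n], solvable in characteristic 0. *)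
Lemma negbin_fps_odeP b f : f 0%N = 1 ->
  (1 - fpsX) * deriv_fps f = b%:S * f <-> f = negbin_fps b.
Proof.
move=> f0.
have odeE g n : ((1 - fpsX) * deriv_fps g) n = g n.+1 *+ n.+1 - g n *+ n.
  rewrite mulrBl mul1r coef_fpsB coef_fpsX_mul.
  by case: n => [|n]; rewrite ?mulr0n.
have recE n : (negbin_fps b n.+1) *+ n.+1 = (b + n%:R) * negbin_fps b n.
  have n1 : n.+1%:R != 0 :> K by rewrite pnatr_eq0.
  rewrite -[LHS]mulr_natr /= pochhammerS factS natrM.
  move: (n`!%:R) (factr_neq0 n) (n.+1%:R) n1 (pochhammer b n) => y y0 x x0 p.
  by field; rewrite x0 y0.
split=> [ode|->].
  apply: fpsP; elim=> [|n IHn]; first by rewrite f0 negbin_fps0.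
  move/(congr1 (fun g : fps K => g n)): ode.
  rewrite odeE coef_const_fpsM IHn => /eqP; rewrite subr_eq => /eqP eqf.
  have n1 : n.+1%:R != 0 :> K by rewrite pnatr_eq0.
  by apply: (mulIf n1); rewrite !mulr_natr eqf recE mulrDl mulr_natl.
by apply: fpsP => n; rewrite odeE recE coef_const_fpsM mulrDl mulr_natl addrK.
Qed.

(** By Leibniz' rule, the logarithmic derivatives [b / (1 - t)] and
    [c / (1 - t)] of the factors add up. *)
Lemma negbin_fpsM b c : negbin_fps b * negbin_fps c = negbin_fps (b + c).
Proof.
apply/negbin_fps_odeP; first by rewrite coef_fpsM0 !negbin_fps0 mulr1.
have /negbin_fps_odeP odeb := erefl (negbin_fps b).
have /negbin_fps_odeP odec := erefl (negbin_fps c).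
rewrite deriv_fpsM mulrDr [_ * (deriv_fps _ * _)]mulrA odeb ?negbin_fps0 //.
rewrite [_ * (_ * deriv_fps _)]mulrCA odec ?negbin_fps0 //.
have -> : (b + c)%:S = b%:S + c%:S :> fps K.
  by apply: fpsP => -[|n]; rewrite coef_fpsD //= addr0.
by rewrite [negbin_fps b * (_ * _)]mulrCA -mulrA -mulrDl.
Qed.

Lemma negbin_fpsX b k : negbin_fps b ^+ k = negbin_fps (b *+ k).
Proof.
elim: k => [|k IHk]; last by rewrite exprS IHk negbin_fpsM -mulrS.
apply: fpsP => n; rewrite coef_fps1 mulr0n.
case: n => [|n]; first by rewrite negbin_fps0.
by rewrite /= /pochhammer big_ord_recl addr0 mul0r mul0r.
Qed.

Lemma mul_1BX_negbin1 : (1 - fpsX) * negbin_fps 1 = 1.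
Proof.
apply: fpsP => n; rewrite mulrBl mul1r coef_fpsB coef_fpsX_mul coef_fps1.
case: n => [|n]; first by rewrite negbin_fps0 subr0.
by rewrite /= !pochhammer1 !divff ?subrr ?factr_neq0.
Qed.

Lemma unit_1BX : (1 - fpsX : fps K) \is a GRing.unit.
Proof.
by apply/unitrPr; exists (negbin_fps 1); rewrite mul_1BX_negbin1.
Qed.

Lemma invr1BX : (1 - fpsX)^-1 = negbin_fps 1.
Proof. by apply: (mulrI unit_1BX); rewrite mulrV ?unit_1BX ?mul_1BX_negbin1. Qed.

Lemma pow1p_compNX b : pow1p_fps (- b) \So (- fpsX) = negbin_fps b.
Proof.
apply: fpsP => n; rewrite coef_compNX /= mulrA; congr (_ / _).
rewrite -[X in _ ^+ X]card_ord -prodrN; apply: eq_bigr => i _.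
by rewrite opprB opprK addrC.
Qed.

Lemma deriv_exp_comp R : R 0%N = 0 ->
  deriv_fps (exp_fps \So R) = deriv_fps R * (exp_fps \So R).
Proof.
move=> R0; apply: fpsP => n; rewrite coef_mul_comp //.
transitivity (\sum_(k < n.+2) exp_fps k * deriv_fps (R ^+ k) n).
  by rewrite [LHS]/= -sumrMnl; apply: eq_bigr => k _; rewrite -mulrnAr.
rewrite big_ord_recl [X in _ * X](_ : _ = 0) ?mulr0 ?add0r; last first.
  by rewrite expr0 -[LHS]/((1 : fps K) n.+1 *+ n.+1) coef_fps1 mul0rn.
apply: eq_bigr => k _; rewrite lift0 deriv_fpsX coef_fpsMn mulrnAr -mulrnAl.
rewrite [R ^+ _ * _]mulrC; congr (_ * _).
rewrite /= factS natrM invfM -[LHS]mulr_natr mulrAC mulVf ?mul1r //.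
by rewrite pnatr_eq0.
Qed.

(** The exponent [R = - a ln(1 - t)] satisfies [(1 - t) R' = a]. *)
Lemma exp_comp_ln a :
  exp_fps \So (- (a%:S * (ln1p_fps \So (- fpsX)))) = negbin_fps a.
Proof.
set R := - _.
have RE n : R n = a / n%:R.
  rewrite coef_fpsN coef_const_fpsM coef_compNX /= exprS.
  rewrite -[RHS]mul1r -[X in _ = X * _](sqrr_sign _ n).
  by move: ((-1) ^+ n) => s; ring.
have R0 : R 0%N = 0 by rewrite RE invr0 mulr0.
apply/negbin_fps_odeP; first by rewrite /= big_ord1 fact0 invr1 mul1r coef_fps1.
rewrite deriv_exp_comp // mulrA; congr (_ * _).
have -> : deriv_fps R = a%:S * negbin_fps 1.
  apply: fpsP => n; rewrite coef_const_fpsM [negbin_fps 1 n]/= pochhammer1.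
  rewrite divff ?factr_neq0 // -[LHS]/(R n.+1 *+ n.+1) RE.
  by rewrite -[LHS]mulr_natr divfK ?pnatr_eq0 // mulr1.
by rewrite mulrCA mul_1BX_negbin1 mulr1.
Qed.

End Binomial.

(** * The Laguerre generating functions *)

Section LaguerreGenfun.
Variable K : numFieldType.
Variable a : K.
Hypothesis ha : forall k : nat, a != - k.+1%:R.
Implicit Types (k m n : nat).

(** The factor [(a+1)_k] of [(a+1)_(k+m)] cancels the one in the denominator of
    [1F1], which is nonzero since [a] is not a negative integer. *)
Lemma coef_laguerre k m :
  (laguerre a (k + m))`_k
  = (-1) ^+ m * 'C(k + m, k)%:R * pochhammer (a + 1 + k%:R) m.
Proof.
rewrite coefZ coef_poly ltnS leq_addr /= pochhammerD exprD.
have pk : pochhammer (a + 1) k != 0 by apply: pochhammer_neq0.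
have := bin_fact (leq_addr m k); rewrite addKn => /(congr1 (fun n => n%:R : K)).
rewrite !natrM => binE; have := pochhammer_natN K k m; rewrite -binE.
have [fk fm] := (factr_neq0 K k, factr_neq0 K m).
move: 'C(_, _)%:R k`!%:R fk m`!%:R fm (pochhammer _ m) (pochhammer (- _) k) pk.
move: (pochhammer _ k) => p C x x0 y y0 q r p0 rE.
have -> : r = (-1) ^+ k * (C * x) by apply: (mulIf y0); rewrite rE; ring.
have : (-1) ^+ k * (-1) ^+ k = 1 :> K by rewrite -expr2 sqrr_sign.
move: ((-1) ^+ k) ((-1) ^+ m) => s t ss.
rewrite [LHS](_ : _ = (s * s) * t * C * q); first by rewrite ss mul1r.
by field; rewrite x0 p0.
Qed.

Lemma size_laguerre_leq n : (size (laguerre a n) <= n.+1)%N.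
Proof. by rewrite (leq_trans (size_scale_leq _ _)) ?size_poly. Qed.

Lemma laguerre_monic : monic_poly_set (laguerre a).
Proof.
move=> n; have lc1 : (laguerre a n)`_n = 1.
  by have := coef_laguerre n 0; rewrite addn0 binn !mul1r pochhammer0.
have sz : size (laguerre a n) = n.+1.
  apply/eqP; rewrite eqn_leq size_laguerre_leq ltnNge.
  by apply/negP => /leq_sizeP /(_ n (leqnn n)) /eqP; rewrite lc1 oner_eq0.
by rewrite monicE lead_coefE sz lc1.
Qed.

Let alpha1 n : K := (-1) ^+ n / n`!%:R.
Let alpha2 n : K := (-1) ^+ n / pochhammer (a + 1) n.

(** In the series of (1) the coefficient of [x^k] is, up to a factor [t^k] and a
    constant, [(1 - t)^(-(a+1+k))]. *)
Lemma coef_alpha1_laguerre k m :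
  alpha1 (k + m) * (laguerre a (k + m))`_k
  = alpha1 k * negbin_fps (a + 1 + k%:R) m.
Proof.
rewrite coef_laguerre /alpha1 exprD /=.
have := bin_fact (leq_addr m k); rewrite addKn => /(congr1 (fun n => n%:R : K)).
rewrite !natrM => binE; rewrite -binE.
have C0 : 'C(k + m, k)%:R != 0 :> K by rewrite pnatr_eq0 -lt0n bin_gt0 leq_addr.
have [fk fm] := (factr_neq0 K k, factr_neq0 K m).
have : (-1) ^+ m * (-1) ^+ m = 1 :> K by rewrite -expr2 sqrr_sign.
move: ('C(_, _)%:R) C0 (k`!%:R) fk (m`!%:R) fm (pochhammer _ m) => C C0 x x0 y y0 p.
move: ((-1) ^+ k) ((-1) ^+ m) => s t ss.
rewrite [LHS](_ : _ = (t * t) * (s / x * (p / y))); first by rewrite ss mul1r.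
by field; rewrite x0 y0 C0.
Qed.

(** In (2) the exponent is [-(1+k)] instead: the normalisation [alpha2] cancels
    the Pochhammer symbols in the Laguerre coefficients and leaves [C(k+m,k)]. *)
Lemma coef_alpha2_laguerre k m :
  alpha2 (k + m) * (laguerre a (k + m))`_k
  = alpha2 k * negbin_fps (1 + k%:R) m.
Proof.
rewrite coef_laguerre /alpha2 exprD /= pochhammerD.
have := bin_fact (leq_addr m k); rewrite addKn => /(congr1 (fun n => n%:R : K)).
rewrite -[(k + m)`!%:R]pochhammer1 pochhammerD pochhammer1 !natrM => binE.
have [fk fm] := (factr_neq0 K k, factr_neq0 K m).
have -> : pochhammer (1 + k%:R) m = 'C(k + m, k)%:R * m`!%:R :> K.
  by apply: (mulfI fk); rewrite -binE; ring.
have : (-1) ^+ m * (-1) ^+ m = 1 :> K by rewrite -expr2 sqrr_sign.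
have : pochhammer (a + 1) k != 0 by apply: pochhammer_neq0.
have : pochhammer (a + 1 + k%:R) m != 0.
  have := pochhammer_neq0 (k + m) ha.
  by rewrite pochhammerD mulf_eq0 negb_or => /andP[].
move: (pochhammer _ m) (pochhammer _ k) (m`!%:R) fm 'C(_, _)%:R => p q y y0 C p0 q0.
move: ((-1) ^+ k) ((-1) ^+ m) => s t ss.
rewrite [LHS](_ : _ = (t * t) * (s / q * (C * y / y))); first by rewrite ss mul1r.
by field; rewrite p0 q0 y0.
Qed.

Lemma is_genfun_laguerre1 : is_genfun (laguerre a) (laguerre_gf1 a).
Proof.
rewrite /laguerre_gf1; set R := - (a%:S * _).
have R0 : R 0%N = 0.
  by rewrite coef_fpsN coef_const_fpsM coef_compNX /= invr0 !mulr0 oppr0.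
split; first exact: laguerre_monic.
- split=> [n|]; last by rewrite expr0 fact0 divr1.
  by rewrite mulf_neq0 ?invr_eq0 ?factr_neq0 ?signr_eq0.
- by apply: fpsP => n; rewrite coef_compNX.
- by rewrite invr1BX negbin_fps0.
apply/genfunP => // [n|k m].
  by rewrite (leq_trans (size_scale_leq _ _)) ?size_laguerre_leq.
rewrite coefZ coef_alpha1_laguerre -[a + 1 + _]addrA nat1r [a + _]addrC.
rewrite -negbin_fpsM -(exp_comp_ln a) coef_mul_comp // mulr_sumr -exprS.
rewrite invr1BX negbin_fpsX; apply: eq_bigr => i _.
rewrite [(- R) ^+ i]exprNn -const_fpsN1 -const_fps_exp coef_compNX.
rewrite [_ * (_%:S * _)]mulrCA coef_const_fpsM -[X in _ = _ * X]mulr_natr.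
rewrite -/R; move: (coef_fps _ m) => z.
have := bin_fact (leq_addr i k); rewrite addKn => /(congr1 (fun n => n%:R : K)).
rewrite !natrM /alpha1 exprD /= => <-.
have C0 : 'C(k + i, k)%:R != 0 :> K by rewrite pnatr_eq0 -lt0n bin_gt0 leq_addr.
have [fk fi] := (factr_neq0 K k, factr_neq0 K i).
have := sqrr_sign K i.
move: ('C(_, _)%:R) C0 (k`!%:R) fk (i`!%:R) fi => C C0 x x0 y y0.
move: ((-1) ^+ k) ((-1) ^+ i) => s t ss.
rewrite [RHS](_ : _ = t ^+ 2 * (s / x * (y^-1 * z))); first by rewrite ss mul1r.
by field; rewrite x0 y0 C0.
Qed.

Lemma lift_invr1BX : lift_fps (1 - fpsX)^-1 = (1 - fpsX)^-1 :> fps {poly K}.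
Proof.
rewrite (rmorphV _ (unit_1BX K)) rmorphB rmorph1; congr ((1 - _)^-1).
exact: lift_fpsX.
Qed.

Lemma laguerre_argE :
  laguerre_arg = 'X%:S * fpsX * lift_fps (- negbin_fps 1) :> fps {poly K}.
Proof.
rewrite /laguerre_arg -[fpsX - 1]opprB invrN -lift_invr1BX invr1BX.
by congr (_ * _); rewrite rmorphN.
Qed.

Lemma laguerre_genfun1 :
  Fps (fun n => alpha1 n *: laguerre a n)
  = lift_fps (pow1p_fps (- a - 1) \So (- fpsX))
    * (lift_fps exp_fps \So laguerre_arg).
Proof.
apply/esym; rewrite -opprD pow1p_compNX laguerre_argE; apply/genfun0P => [n|k m].
  by rewrite (leq_trans (size_scale_leq _ _)) ?size_laguerre_leq.
rewrite coefZ coef_alpha1_laguerre exprNn -const_fpsN1 -const_fps_exp.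
rewrite [_ * (_%:S * _)]mulrCA coef_const_fpsM negbin_fpsX negbin_fpsM.
by rewrite [RHS]mulrA [exp_fps k * _]mulrC.
Qed.

Lemma hyp1F1_alpha2 k : (-1) ^+ k * hyp1F1_fps 1 (a + 1) k = alpha2 k.
Proof.
by rewrite /= pochhammer1 invfM [k`!%:R * _]mulrCA divff ?mulr1 ?factr_neq0.
Qed.

Lemma laguerre_genfun2 :
  Fps (fun n => alpha2 n *: laguerre a n)
  = (1 - fpsX)^-1 * (lift_fps (hyp1F1_fps 1 (a + 1)) \So laguerre_arg).
Proof.
rewrite -lift_invr1BX invr1BX; apply/esym; rewrite laguerre_argE; apply/genfun0P => [n|k m].
  by rewrite (leq_trans (size_scale_leq _ _)) ?size_laguerre_leq.
rewrite coefZ coef_alpha2_laguerre exprNn -const_fpsN1 -const_fps_exp.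
rewrite [_ * (_%:S * _)]mulrCA coef_const_fpsM negbin_fpsX negbin_fpsM.
by rewrite -hyp1F1_alpha2 [RHS]mulrA [hyp1F1_fps _ _ k * _]mulrC.
Qed.

Lemma is_genfun_laguerre2 : is_genfun (laguerre a) (laguerre_gf2 a).
Proof.
split; first exact: laguerre_monic.
- split=> [n|]; last by rewrite pochhammer0 divr1.
  by rewrite mulf_neq0 ?invr_eq0 ?signr_eq0 ?pochhammer_neq0.
- by apply: fpsP => n; rewrite coef_compNX hyp1F1_alpha2.
- by rewrite invr1BX negbin_fps0.
rewrite rmorph0 subr0; apply/genfun0P => [n|k m].
  by rewrite (leq_trans (size_scale_leq _ _)) ?size_laguerre_leq.
rewrite coefZ coef_alpha2_laguerre coef_compNX hyp1F1_alpha2 -exprS.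
by rewrite invr1BX negbin_fpsX nat1r.
Qed.

End LaguerreGenfun.

(** * A generating function is determined by its sequence [alpha] *)

Section Uniqueness.
Variable K : numFieldType.
Implicit Types (f g A R : fps K).

Lemma coef_fpsM_S f g m :
  (f * g) m.+1
  = f 0%N * g m.+1 + \sum_(i < m) f i.+1 * g (m - i)%N + f m.+1 * g 0%N.
Proof.
rewrite coef_fpsM big_ord_recl big_ord_recr [LHS]/= subn0 subnn addrA.
by congr (_ + _ + _); apply: eq_bigr => i _; rewrite /bump /= add1n subSS.
Qed.

(** Modulo the next power of [t], multiplication is linear in perturbations
    of order [m + 1] of its arguments. *)
Lemma coef_fpsM_diff m f f' g g' :
    (forall i, (i <= m)%N -> f i = f' i) -> (forall i, (i <= m)%N -> g i = g' i) ->
  (f * g) m.+1 - (f' * g') m.+1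
  = (f m.+1 - f' m.+1) * g 0%N + f 0%N * (g m.+1 - g' m.+1).
Proof.
move=> eqf eqg; rewrite !coef_fpsM_S -(eqf 0%N) // -(eqg 0%N) //.
rewrite [X in _ - (_ + X + _)](_ : _ = \sum_(i < m) f i.+1 * g (m - i)%N).
  by ring.
by apply: eq_bigr => i _; rewrite eqf // eqg // leq_subr.
Qed.

Lemma coef_fpsM_eq m f f' g g' :
    (forall i, (i <= m)%N -> f i = f' i) -> (forall i, (i <= m)%N -> g i = g' i) ->
  forall i, (i <= m)%N -> (f * g) i = (f' * g') i.
Proof.
move=> eqf eqg i le_im; rewrite !coef_fpsM; apply: eq_bigr => j _.
by rewrite eqf ?eqg ?(leq_trans (leq_subr _ _)) // (leq_trans _ le_im) // -ltnS.
Qed.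

Lemma coef_fpsX_eq m f g k : (forall i, (i <= m)%N -> f i = g i) ->
  forall i, (i <= m)%N -> (f ^+ k) i = (g ^+ k) i.
Proof.
move=> eqfg; elim: k => [|k IHk i le_im]; first by [].
by rewrite !exprS (coef_fpsM_eq eqfg IHk).
Qed.

Lemma coef_fpsX_diff m f g k : f 0%N = 1 -> (forall i, (i <= m)%N -> f i = g i) ->
  (f ^+ k) m.+1 - (g ^+ k) m.+1 = (f m.+1 - g m.+1) *+ k.
Proof.
move=> f0 eqfg; elim: k => [|k IHk]; first by rewrite subrr.
rewrite !exprS (coef_fpsM_diff eqfg (coef_fpsX_eq k eqfg)) IHk f0 coef_fps_exp0 f0.
by rewrite expr1n mulr1 mul1r -mulrS.
Qed.

(** At order [m + 1] the new coefficients [A_(m+1)] and [R_(m+1)] enter only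
    through the terms [i = 0] and [i = 1] respectively: as [R] has no constant
    term, a perturbation of [R] at order [m + 1] affects [R^i], [i >= 2], at
    higher order only. *)
Lemma genfun_linear_part k m (F : nat -> K) A A' R R' :
    A 0%N = 1 -> R 0%N = 0 ->
    (forall i, (i <= m)%N -> A i = A' i) -> (forall i, (i <= m)%N -> R i = R' i) ->
  \sum_(i < m.+2) F (k + i)%N * ((A ^+ k.+1 * (- R) ^+ i) m.+1 *+ 'C(k + i, k))
  - \sum_(i < m.+2) F (k + i)%N * ((A' ^+ k.+1 * (- R') ^+ i) m.+1 *+ 'C(k + i, k))
  = k.+1%:R * (F k * (A m.+1 - A' m.+1) - F k.+1 * (R m.+1 - R' m.+1)).
Proof.
move=> A0 R0 eqA eqR.
have eqN i : (i <= m)%N -> (- R) i = (- R') i.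
  by move=> /eqR; rewrite !coef_fpsN => ->.
have N0 : (- R) 0%N = 0 by rewrite coef_fpsN R0 oppr0.
have diffE i : (A ^+ k.+1 * (- R) ^+ i) m.+1 - (A' ^+ k.+1 * (- R') ^+ i) m.+1
    = (A m.+1 - A' m.+1) *+ k.+1 * 0 ^+ i
      + (((- R) ^+ i) m.+1 - ((- R') ^+ i) m.+1).
  rewrite (coef_fpsM_diff (coef_fpsX_eq _ eqA) (coef_fpsX_eq i eqN)).
  rewrite (coef_fpsX_diff _ A0 eqA) !coef_fps_exp0 A0 N0.
  by rewrite expr1n mul1r.
rewrite -sumrB; under eq_bigr => i _ do rewrite -mulrBr -mulrnBl diffE.
rewrite 2!big_ord_recl big1 => [|i _]; last first.
  rewrite !lift0 exprS mul0r mulr0 add0r exprS [(- R') ^+ _]exprS.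
  rewrite (coef_fpsM_diff eqN (coef_fpsX_eq _ eqN)) N0 mul0r addr0.
  by rewrite coef_fps_exp0 N0 exprS mul0r mulr0 mul0rn mulr0.
rewrite [ord0 : nat]/= addn0 binn lift0 [ord0 : nat]/= addn1 binSn !expr0 !expr1.
rewrite subrr !coef_fpsN.
by rewrite addr0 mulr0 add0r; ring.
Qed.

(** Comparing the coefficients of [x^0] and [x^1] at each order gives a linear
    system for the next coefficients of [A] and [R], whose determinant is a
    nonzero multiple of [alpha_1^2 - alpha_2]. The condition excludes such
    sequences as [alpha_n = 1]: then [F = 1 / (1 - t)], and
    [A F(x t A - R) = 1 / ((1 + R) / A - x t)] depends on [(1 + R) / A] only. *)
Lemma genfun_uniq P (d d' : genfun_data K) :
    is_genfun P d -> is_genfun P d' -> gf_alpha d =1 gf_alpha d' ->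
  gf_alpha d 1%N ^+ 2 != gf_alpha d 2%N -> d = d'.
Proof.
case: d d' => alpha A R F [alpha' A' R' F'].
move=> [mP [alpha_neq0 alpha0] -> [A0 R0] genE] [_ _ -> [A'0 R'0] genE'] /= /funext.
move=> eqalpha; rewrite -{}eqalpha in genE' * => det_neq0.
have szP n : (size (alpha n *: P n)%R <= n.+1)%N.
  by rewrite (leq_trans (size_scale_leq _ _)) // (mP n).2.
move/genfunP: genE => /(_ R0 szP) genE.
move/genfunP: genE' => /(_ R'0 szP) genE'.
suff eqAR n : A n = A' n /\ R n = R' n.
  by congr (GenFun _ _ _ _); apply: fpsP => n; have [] := eqAR n.
have [m] := ubnP n; elim: m n => // m IHm [|n]; first by rewrite A0 R0 A'0 R'0.
rewrite !ltnS => lt_nm.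
have IH i : (i <= n)%N -> A i = A' i /\ R i = R' i.
  by move=> le_in; apply: IHm; rewrite (leq_ltn_trans le_in).
have eqA i : (i <= n)%N -> A i = A' i by case/IH.
have eqR i : (i <= n)%N -> R i = R' i by case/IH.
have lin k : alpha k * (A n.+1 - A' n.+1) = alpha k.+1 * (R n.+1 - R' n.+1).
  have := genfun_linear_part k (Fps alpha) A0 R0 eqA eqR.
  rewrite [A ^+ _]exprS [A' ^+ _]exprS -(genE k n.+1) -(genE' k n.+1) subrr.
  by move/esym/eqP; rewrite mulf_eq0 pnatr_eq0 /= subr_eq0 => /eqP.
have := lin 0%N; rewrite alpha0 mul1r => uE; have := lin 1%N; rewrite uE mulrA -expr2.
move/eqP; rewrite -subr_eq0 -mulrBl mulf_eq0 [_ - _ == 0]subr_eq0.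
rewrite (negbTE det_neq0) /= => /eqP v0.
by move: uE; rewrite v0 mulr0 => /subr0_eq ->; move/subr0_eq: v0 => ->.
Qed.

End Uniqueness.

(** * The converse *)

Section LowOrder.
Variable K : comNzRingType.
Implicit Types f g A : fps K.

Lemma coef1_fpsM f g : (f * g) 1%N = f 0%N * g 1%N + f 1%N * g 0%N.
Proof. by rewrite coef_fpsM !big_ord_recl big_ord0 addr0. Qed.

Lemma coef2_fpsM f g :
  (f * g) 2%N = f 0%N * g 2%N + f 1%N * g 1%N + f 2%N * g 0%N.
Proof. by rewrite coef_fpsM !big_ord_recl big_ord0 addr0 addrA. Qed.

Lemma coef1_fpsX A k : A 0%N = 1 -> (A ^+ k) 1%N = k%:R * A 1%N.
Proof.
move=> A0; elim: k => [|k IHk]; first by rewrite coef_fps1 mul0r.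
by rewrite exprS coef1_fpsM IHk A0 coef_fps_exp0 A0 expr1n -natr1; ring.
Qed.

Lemma coef2_fpsX A k : A 0%N = 1 ->
  2%:R * (A ^+ k) 2%N
  = k%:R * (2%:R * A 2%N) + k%:R * (k%:R - 1) * A 1%N ^+ 2.
Proof.
move=> A0; elim: k => [|k IHk]; first by rewrite coef_fps1 !mul0r mulr0 addr0.
rewrite exprS coef2_fpsM coef1_fpsX // A0 coef_fps_exp0 A0 expr1n.
by rewrite mul1r !mulrDr IHk -natr1; ring.
Qed.

End LowOrder.

Section Converse.
Variable K : numFieldType.
Variable a : K.
Hypothesis ha : forall k : nat, a != - k.+1%:R.
Variables (alpha : nat -> K) (A R F : fps K).
Hypothesis gfd : is_genfun (laguerre a) (GenFun alpha A R F).

(** The quantity that separates the two families: it is [0] in (1) and [- a]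
    in (2). *)
Let r := R 1%N - a.

Lemma genfun_laguerre_coef k m :
  alpha (k + m)%N * ((-1) ^+ m * 'C(k + m, k)%:R * pochhammer (a + 1 + k%:R) m)
  = \sum_(i < m.+1) alpha (k + i)%N * ((A ^+ k.+1 * (- R) ^+ i) m *+ 'C(k + i, k)).
Proof.
case: gfd => mP _ -> [_ R0] /genfunP => /(_ R0) genE.
rewrite -coef_laguerre // -coefZ exprS genE // => n.
by rewrite (leq_trans (size_scale_leq _ _)) // (mP n).2.
Qed.

(** The relations for [m = 1], divided by [k + 1]. *)
Lemma alpha_rec k : alpha k.+1 * (r - k.+1%:R) = A 1%N * alpha k.
Proof.
case: gfd => _ [_ _] _ [A0 R0] _.
have := genfun_laguerre_coef k 1; rewrite !big_ord_recl big_ord0 addn0 addn1.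
rewrite binn lift0 [ord0 : nat]/= binSn expr0 mulr1 expr1 coef1_fpsM.
rewrite coef1_fpsX // coef_fps_exp0 A0 expr1n !coef_fpsN R0.
rewrite pochhammerS pochhammer0 => eq1.
have k1 : k.+1%:R != 0 :> K by rewrite pnatr_eq0.
apply: (mulfI k1); apply/eqP; rewrite -subr_eq0.
move/eqP: eq1; rewrite -subr_eq0 => /eqP eq1; rewrite /r.
by apply/eqP; rewrite -[RHS]eq1 -natr1; ring.
Qed.

(** If [A_1] were zero, the recurrence would force [r = k + 1] for all [k]. *)
Lemma genfun_A1_neq0 : A 1%N != 0.
Proof.
case: gfd => _ [alpha_neq0 _] _ _ _; apply/eqP => A1.
have re k : r = k.+1%:R.
  apply/subr0_eq/eqP; move/eqP: (alpha_rec k).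
  by rewrite A1 mul0r mulf_eq0 (negbTE (alpha_neq0 _)).
by have := re 0%N; rewrite (re 1%N) => /eqP; rewrite eqr_nat.
Qed.

(** Equality would give [alpha_1^2 (r - 2) = alpha_1^2 (r - 1)] by the first
    two instances of the recurrence. *)
Lemma alpha_det_neq0 : alpha 1%N ^+ 2 != alpha 2%N.
Proof.
case: gfd => _ [alpha_neq0 alpha0] _ _ _; apply/eqP => det.
have [e0 e1] := (alpha_rec 0, alpha_rec 1); rewrite -det in e1.
have : alpha 1%N ^+ 2
     = alpha 1%N * (alpha 1%N * (r - 1%:R)) - alpha 1%N ^+ 2 * (r - 2%:R) by ring.
rewrite e0 e1 alpha0 mulr1 mulrC subrr => /eqP.
by rewrite expf_eq0 (negbTE (alpha_neq0 _)).
Qed.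

(** The second order coefficients, made invariant under rescaling of [t]. *)
Let b := A 2%N / A 1%N ^+ 2.
Let rho := R 2%N / A 1%N.

(** As a polynomial in [x], this has degree at most 2: the leading terms [x^3]
    cancel. *)
Let quad (x : K) :=
  (x + 2) * (a + x + 1) * (a + x + 2)
  - ((r - x - 1) * (r - x - 2) * (2 * b + x)
     - 2 * (r - x - 2) * (rho + (x + 1) * R 1%N) + (x + 2) * R 1%N ^+ 2).

(** Twice the relation for [m = 2], divided by [(k + 1) alpha_(k+2)]; the
    recurrence expresses [alpha_k] and [alpha_(k+1)] through [alpha_(k+2)]. *)
Lemma genfun_quad_root (k : nat) : quad k%:R = 0.
Proof.
apply/eqP; rewrite subr_eq0; apply/eqP; set x := k%:R.
case: gfd => _ [alpha_neq0 _] _ [A0 R0] _.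
have := genfun_laguerre_coef k 2; rewrite !big_ord_recl big_ord0 addn0 addn2.
rewrite !lift0 [ord0 : nat]/= addn1 binn binSn expr0 mulr1 expr1 expr2.
rewrite !coef2_fpsM !coef1_fpsM coef_fpsM0 coef1_fpsX // coef_fps_exp0 A0 expr1n.
rewrite !coef_fpsN R0 !pochhammerS pochhammer0 => eq2.
have binE : 2%:R * 'C(k.+2, k)%:R = (x + 2) * (x + 1).
  have -> : 'C(k.+2, k) = 'C(k.+2, 2).
    by rewrite -[RHS]bin_sub // subn2.
  by rewrite -natrM -mul_bin_diag bin1 natrM -!natr1 /x; ring.
have c0 := genfun_A1_neq0.
have A2E : A 2%N = b * A 1%N ^+ 2 by rewrite /b divfK // expf_neq0.
have R2E : R 2%N = rho * A 1%N by rewrite /rho divfK.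
have rec1 : alpha k.+2 * (r - x - 2) = A 1%N * alpha k.+1.
  by rewrite -alpha_rec -!natr1 /x; ring.
have rec01 : alpha k.+2 * (r - x - 1) * (r - x - 2) = A 1%N ^+ 2 * alpha k.
  by rewrite expr2 -[RHS]mulrA -alpha_rec [RHS]mulrA -rec1 -natr1 /x; ring.
have x1 : (x + 1) * alpha k.+2 != 0 by rewrite mulf_neq0 // natr1 pnatr_eq0.
have pow2 : 2%:R * (A ^+ k.+1) 2%N
    = (x + 1) * (2 * (b * A 1%N ^+ 2)) + (x + 1) * x * A 1%N ^+ 2.
  by rewrite coef2_fpsX // A2E -natr1 /x; ring.
apply: (mulfI x1).
transitivity ((x + 1) * (A 1%N ^+ 2 * alpha k * (2 * b + x)
   - 2 * (A 1%N * alpha k.+1) * (rho + (x + 1) * R 1%N)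
   + alpha k.+2 * (x + 2) * R 1%N ^+ 2)); last by rewrite -rec01 -rec1; ring.
transitivity (2%:R * 'C(k.+2, k)%:R * (alpha k.+2 * (a + 1 + x) * (a + 1 + x + 1))).
  by rewrite binE; ring.
transitivity (alpha k * (2%:R * (A ^+ k.+1) 2%N)
   - 2%:R * alpha k.+1 * ((rho * A 1%N + (x + 1) * A 1%N * R 1%N) * (x + 1))
   + alpha k.+2 * (2%:R * 'C(k.+2, k)%:R) * R 1%N ^+ 2).
  move/(congr1 (fun y => 2%:R * y))/eqP: eq2; rewrite -subr_eq0 => /eqP eq2.
  by apply/subr0_eq; rewrite -[RHS]eq2 R2E /x; ring.
by rewrite pow2 binE; ring.
Qed.

(** The coefficient of [x^2] in [quad] vanishes only if [b = 1]; the value at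
    [-2] is then [2 r (rho - R_1)]. *)
Lemma genfun_r_cases : r = 0 \/ r = - a.
Proof.
have [D0 D1] := (genfun_quad_root 0, genfun_quad_root 1).
have D2 := genfun_quad_root 2; rewrite mulr0n mulr1n in D0 D1.
have R1E : R 1%N = r + a by rewrite /r subrK.
have b1 : b = 1.
  (* The second difference is twice the coefficient [2 (1 - b)] of [x^2]. *)
  have : 4 * (1 - b) = quad 2 - 2 * quad 1 + quad 0.
    by rewrite /quad R1E; ring.
  rewrite D0 D1 D2 mulr0 subrr add0r => /eqP; rewrite mulf_eq0 pnatr_eq0 /= subr_eq0.
  by move/eqP.
(* At [x = -2] both [x + 2] and [2 * b + x] vanish; the right-hand side is
   the extrapolation to [-2] of the linear function [quad]. *)
have : 2 * r * (rho - R 1%N) = 3 * quad 0 - 2 * quad 1.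
  by rewrite /quad b1 R1E; ring.
rewrite D0 D1 !mulr0 subr0 => /eqP.
rewrite -mulrA mulf_eq0 pnatr_eq0 /= mulf_eq0 => /orP[/eqP ->|]; first by left.
rewrite subr_eq0 => /eqP rhoE; right; apply/eqP; rewrite -subr_eq0 opprK.
(* With [rho = R_1] moreover, [quad] has slope [- (r + a)]. *)
have -> : r + a = quad 0 - quad 1 by rewrite /quad rhoE b1 R1E; ring.
by rewrite D0 D1 subrr.
Qed.

Lemma genfun_laguerre_converse :
  exists2 c : K, c != 0 &
    GenFun alpha A R F = rescale c (laguerre_gf1 a)
    \/ GenFun alpha A R F = rescale c (laguerre_gf2 a).
Proof.
have c0 := genfun_A1_neq0; exists (A 1%N) => //.
case: (gfd) => _ [_ alpha0] _ _ _.
have sgn n : (-1) ^+ n.+1 = - (-1) ^+ n :> K by rewrite exprS mulN1r.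
have [rE|rE] := genfun_r_cases; [left|right].
  apply: (genfun_uniq gfd (is_genfun_rescale c0 (is_genfun_laguerre1 ha))).
    elim=> [|n IHn]; first by rewrite /= alpha0 expr0 fact0 divr1 mulr1.
    have := alpha_rec n; rewrite /= in IHn *.
    have n1 : n.+1%:R != 0 :> K by rewrite pnatr_eq0.
    rewrite rE sub0r IHn factS natrM => recn.
    have n1N : - n.+1%:R != 0 :> K by rewrite oppr_eq0.
    apply: (mulIf n1N); rewrite recn exprS sgn.
    move: (factr_neq0 K n) (n.+1%:R) n1 {recn n1N} => nf y y0.
    by field; rewrite nf y0.
  exact: alpha_det_neq0.
apply: (genfun_uniq gfd (is_genfun_rescale c0 (is_genfun_laguerre2 ha))).
  elim=> [|n IHn]; first by rewrite /= alpha0 expr0 pochhammer0 divr1 mulr1.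
  have := alpha_rec n; rewrite /= in IHn *.
  rewrite rE IHn pochhammerS => recn.
  have := pochhammer_neq0 n.+1 ha.
  rewrite pochhammerS mulf_eq0 negb_or => /andP[nf n1].
  have n1' : - (a + 1 + n%:R) != 0 by rewrite oppr_eq0.
  apply: (mulIf n1'); rewrite exprS sgn [LHS](_ : _ = alpha n.+1 * (- a - n.+1%:R)).
    by rewrite recn; field; rewrite nf n1.
  by rewrite -natr1; ring.
exact: alpha_det_neq0.
Qed.

End Converse.

Theorem theorem3p4 (R : realType) (a : R[i]) (ha : forall k : nat, a != - k.+1%:R) :
  [/\ is_genfun (laguerre a) (laguerre_gf1 a),
      Fps (fun n => ((-1) ^+ n / n`!%:R) *: laguerre a n)
      = lift_fps (pow1p_fps (- a - 1) \So (- fpsX))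
        * (lift_fps exp_fps \So laguerre_arg),
      is_genfun (laguerre a) (laguerre_gf2 a),
      Fps (fun n => ((-1) ^+ n / pochhammer (a + 1) n) *: laguerre a n)
      = (1 - fpsX)^-1
        * (lift_fps (hyp1F1_fps 1 (a + 1)) \So laguerre_arg) &
      forall d : genfun_data R[i], is_genfun (laguerre a) d ->
        exists2 c : R[i], c != 0 &
          d = rescale c (laguerre_gf1 a) \/ d = rescale c (laguerre_gf2 a)].
Proof.
split.
- exact: is_genfun_laguerre1.
- exact: laguerre_genfun1.
- exact: is_genfun_laguerre2.
- exact: laguerre_genfun2.
- by case=> alpha A S F; apply: genfun_laguerre_converse.
Qed.
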